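(* Let $q\in(0,1)$ and let $W=(w_{\mathbf{i}})_{\mathbf{i}\in\mathbb{Z}_+^d}$ have i.i.d. entries with $\mathrm{Prob}(w_{\mathbf{i}}=k)=(1-q)q^k$, $k\in\mathbb{N}$. For $\mathbf{i}\in\mathbb{Z}_+^d$ let $G(\mathbf{i})=\max_{\Pi}\sum_{\mathbf{j}\in\Pi}w_{\mathbf{j}}$, maximum over directed lattice paths $\Pi$ from $(1,\ldots,1)$ to $\mathbf{i}$. Let $n_1,\ldots,n_d\in\mathbb{Z}_+$, let $\rho$ be a $(d-1)$-dimensional partition with $D(\rho)\subseteq[n_2]\times\cdots\times[n_d]\times\mathbb{Z}_+$, put $\mathbf{n}=(n_2+1,\ldots,n_d+1)$ and $N=n_1\cdots n_d$. Then $$\mathrm{Prob}\left( G(n_1, \mathbf{n} - \mathbf{i}) = \rho_{\mathbf{i}} \text{ for all } \mathbf{i} \in [n_2] \times \cdots \times [n_{d}] \right) = (1 - q)^{N}\, g_{\rho}(\underbrace{q,\ldots, q}_{n_1 \text{ times}}).$$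
   Context: Directed lattice paths use only steps $\mathbf{i}\to\mathbf{i}+\mathbf{e}_\ell$, $\ell\in[d]$. A $k$-dimensional partition is an array $\pi=(\pi_{\mathbf{i}})_{\mathbf{i}\in\mathbb{Z}_+^k}$ of nonnegative integers with finitely many nonzero entries, weakly decreasing in each coordinate; $D(\pi)=\{(\mathbf{i},i)\in\mathbb{Z}_+^{k+1}:1\le i\le\pi_{\mathbf{i}}\}$. For a $d$-dimensional partition $\tau$: $\mathrm{Cor}(\tau)=\{\mathbf{i}\in D(\tau):\mathbf{i}+\mathbf{e}_\ell\notin D(\tau)\ \forall\ell\in[d]\}$, $\mathrm{sh}_1(\tau)=\{(i_2,\ldots,i_{d+1}):(i_1,\ldots,i_{d+1})\in D(\tau)\}$, $c_i(\tau)=|\{\mathbf{i}:(i,\mathbf{i})\in\mathrm{Cor}(\tau)\}|$. For variables $x_1,\ldots,x_m$ and a $(d-1)$-dimensional partition $\rho$ with $D(\rho)\subseteq[n_2]\times\cdots\times[n_d]\times\mathbb{Z}_+$, $g_\rho(x_1,\ldots,x_m)=\sum_\tau\prod_{i=1}^m x_i^{c_i(\tau)}$, summed over $d$-dimensional partitions $\tau$ with $D(\tau)\subseteq[m]\times[n_2]\times\cdots\times[n_d]\times\mathbb{Z}_+$ and $\mathrm{sh}_1(\tau)=D(\rho)$. *)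

(* Defs.v *)
From HB Require Import structures.
From mathcomp Require Import all_boot all_order all_algebra.
From mathcomp Require Import finmap.
From mathcomp Require Import all_classical all_reals all_analysis.

Set Implicit Arguments.
Unset Strict Implicit.
Unset Printing Implicit Defensive.

Import Order.TTheory GRing.Theory Num.Theory.

Local Open Scope classical_set_scope.
Local Open Scope nat_scope.

(* Coordinates are 1-based: Z_+^k is the set of k-tuples of naturals with     *)
(* positive entries.  The direction l of a unit vector e_l is 0-based.        *)
Definition Zpos (k : nat) : set (k.-tuple nat) :=
  [set v | forall l : 'I_k, 0 < tnth v l].

Definition add_unit (k : nat) (v : k.-tuple nat) (l : nat) : k.-tuple nat :=
  [tuple tnth v j + (j == l :> nat) | j < k].

Definition box (k : nat) (n : k.-tuple nat) : set (k.-tuple nat) :=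
  [set v | forall l : 'I_k, 1 <= tnth v l <= tnth n l].

(* [n_1] x ... x [n_k] x Z_+ *)
Definition cylinder (k : nat) (n : k.-tuple nat) : set (k.+1.-tuple nat) :=
  [set v | exists (i : k.-tuple nat) (h : nat),
     [/\ v = [tuple of rcons i h], box n i & 0 < h]].

(* An array indexed by Z_+^k is a function on all k-tuples of naturals; the   *)
(* first clause extends it by 0 outside Z_+^k, so that a partition is         *)
(* represented by exactly one function.                                       *)
Definition is_partition (k : nat) (pi : k.-tuple nat -> nat) : Prop :=
  [/\ forall i, ~ Zpos i -> pi i = 0,
      finite_set [set i | pi i <> 0]
    & forall i (l : 'I_k), Zpos i -> pi (add_unit i l) <= pi i].

Definition diagram (k : nat) (pi : k.-tuple nat -> nat) :
    set (k.+1.-tuple nat) :=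
  [set v | exists (i : k.-tuple nat) (h : nat),
     [/\ v = [tuple of rcons i h], Zpos i & 1 <= h <= pi i]].

(* Only the first d of the d + 1 directions are tested. *)
Definition Cor (d : nat) (tau : d.-tuple nat -> nat) : set (d.+1.-tuple nat) :=
  [set v | diagram tau v /\ forall l : 'I_d, ~ diagram tau (add_unit v l)].

Definition sh1 (d : nat) (tau : d.-tuple nat -> nat) : set (d.-tuple nat) :=
  [set v : d.-tuple nat | exists i : nat, diagram tau [tuple of i :: v]].

(* The set is finite when tau is a partition. *)
Definition cor_count (d : nat) (i : nat) (tau : d.-tuple nat -> nat) : nat :=
  #|` fset_set [set v : d.-tuple nat | Cor tau [tuple of i :: v]] |%fset.

(* With d = p + 1: the sum is over tau such that                              *)
(* D(tau) is included in [m] x [n_2] x ... x [n_d] x Z_+ and                  *)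
(* sh_1(tau) = D(rho); there are finitely many of them.                       *)
Definition g (R : comNzRingType) (p m : nat) (n : p.-tuple nat)
    (rho : p.-tuple nat -> nat) (x : m.-tuple R) : R :=
  (\sum_(tau \in [set tau : p.+1.-tuple nat -> nat |
                   [/\ is_partition tau,
                       diagram tau `<=` cylinder [tuple of m :: n]
                     & sh1 tau = diagram rho]])
     \prod_(i < m) tnth x i ^+ cor_count i.+1 tau)%R.

Definition lattice_step (d : nat) : rel (d.-tuple nat) :=
  fun u v => [exists l : 'I_d, v == add_unit u l].

(* A path is the sequence of all its vertices, both ends included. *)
Definition directed_path (d : nat) (a b : d.-tuple nat)
    (s : seq (d.-tuple nat)) : Prop :=
  exists s', [/\ s = a :: s', path (@lattice_step d) a s' & last a s' = b].

(* For i in Z_+^d there are finitely many such paths, and at least one. *)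
Definition lpp (d : nat) (w : d.-tuple nat -> nat) (i : d.-tuple nat) : nat :=
  \big[maxn/0]_(s \in [set s | directed_path [tuple of nseq d 1] i s])
    \sum_(j <- s) w j.

Definition mutually_independent (disp disp' : measure_display)
    (T : measurableType disp) (U : measurableType disp') (R : realType)
    (P : probability T R) (I : choiceType) (D : set I)
    (X : I -> {RV P >-> U}) : Prop :=
  forall (J : {fset I}) (A : I -> set U),
    [set` J] `<=` D -> (forall i, i \in J -> measurable (A i)) ->
    P (\bigcap_(i in [set` J]) (X i @^-1` A i)) =
    (\prod_(i <- J) P (X i @^-1` A i))%E.

(* Main.v *)
(** Reflecting the box [n_1] x ... x [n_d] by i |-> n + 1 - i, the last passage
    times tau_i = G(n + 1 - i) form a d-dimensional partition: the recursion
    G(i) = w_i + max_l G(i - e_l) becomes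
    tau_i = w_(n+1-i) + max_l tau_(i+e_l).  Hence W |-> tau is a bijection from
    weight arrays on the box onto the partitions supported there, with inverse
    w_(n+1-i) = tau_i - max_l tau_(i+e_l), and this difference counts the
    corners of tau lying above i.  The event says that the slice i_1 = 1 of tau
    is rho, i.e. sh_1(tau) = D(rho), and by independence each tau contributes
    (1-q)^N q^(number of corners of tau). *)

Require Import Defs.
From HB Require Import structures.
From mathcomp Require Import all_boot all_order all_algebra.
From mathcomp Require Import finmap zify.
From mathcomp Require Import all_classical all_reals all_analysis.

Set Implicit Arguments.
Unset Strict Implicit.
Unset Printing Implicit Defensive.

Import Order.TTheory GRing.Theory Num.Theory.

Local Open Scope classical_set_scope.
Local Open Scope nat_scope.

(** * Unit steps and the reflection of a box *)

(* Truncated: a coordinate already equal to 0 stays 0. *)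
Definition sub_unit (k : nat) (v : k.-tuple nat) (l : nat) : k.-tuple nat :=
  [tuple tnth v j - (j == l :> nat) | j < k].

(** Truncated subtraction sends a coordinate larger than that of [N] to 0, hence out of Z_+^k, where
    [lpp] vanishes. *)
Definition reflect_box (k : nat) (N i : k.-tuple nat) : k.-tuple nat :=
  [tuple tnth N l + 1 - tnth i l | l < k].

Lemma Zpos_add_unit k (v : k.-tuple nat) l : Zpos v -> Zpos (add_unit v l).
Proof. by move=> v0 j; rewrite tnth_mktuple; have := v0 j; lia. Qed.

Lemma box_Zpos k (N v : k.-tuple nat) : box N v -> Zpos v.
Proof. by move=> Nv l; case/andP: (Nv l). Qed.

Lemma add_unitK k (v : k.-tuple nat) (l : 'I_k) : sub_unit (add_unit v l) l = v.
Proof. by apply: eq_from_tnth => j; rewrite !tnth_mktuple addnK. Qed.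

Lemma sub_unitK k (v : k.-tuple nat) (l : 'I_k) :
  Zpos (sub_unit v l) -> add_unit (sub_unit v l) l = v.
Proof.
move=> v0; apply: eq_from_tnth => j; rewrite !tnth_mktuple.
by have := v0 j; rewrite tnth_mktuple; lia.
Qed.

Lemma sum_add_unit k (v : k.-tuple nat) (l : 'I_k) :
  \sum_(j < k) tnth (add_unit v l) j = (\sum_(j < k) tnth v j).+1.
Proof.
under eq_bigr do rewrite tnth_mktuple.
rewrite big_split /= -addn1; congr addn.
rewrite (bigD1 l) //= eqxx big1 // => j /negPf jl.
by rewrite (inj_eq val_inj) jl.
Qed.

Lemma add_unit_nbox k (N i : k.-tuple nat) l :
  Zpos i -> ~ box N i -> ~ box N (add_unit i l).
Proof.
move=> i0 nb b; apply: nb => j; have := b j; have := i0 j.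
by rewrite tnth_mktuple; lia.
Qed.

Lemma box_reflect k (N i : k.-tuple nat) : box N i -> box N (reflect_box N i).
Proof. by move=> b l; have := b l; rewrite tnth_mktuple; lia. Qed.

Lemma reflect_boxK k (N i : k.-tuple nat) :
  box N i -> reflect_box N (reflect_box N i) = i.
Proof.
move=> b; apply: eq_from_tnth => l; rewrite !tnth_mktuple.
by have := b l; lia.
Qed.

(** Forward neighbours become backward ones, which turns the recursion for [lpp] into one for a
    decreasing array. Truncation does no harm, since a - (b + c) = (a - b) - c holds for all
    naturals. *)
Lemma reflect_add_unit k (N i : k.-tuple nat) l :
  reflect_box N (add_unit i l) = sub_unit (reflect_box N i) l.
Proof. by apply: eq_from_tnth => j; rewrite !tnth_mktuple subnDA. Qed.

Lemma reflect_box_nZpos k (N i : k.-tuple nat) :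
  Zpos i -> ~ box N i -> ~ Zpos (reflect_box N i).
Proof.
move=> i0 nb r0; apply: nb => l; have := r0 l; have := i0 l.
by rewrite tnth_mktuple; lia.
Qed.

(** * Tuples with a coordinate added at the front or at the end *)

Lemma forall_tnth_cons k (Q : nat -> nat -> Prop) (a b : nat)
    (v w : k.-tuple nat) :
  (forall l, Q (tnth [tuple of a :: v] l) (tnth [tuple of b :: w] l)) <->
  Q a b /\ forall l, Q (tnth v l) (tnth w l).
Proof.
split=> [H|[H0 H] l].
  split; first by have := H ord0; rewrite !tnth0.
  by move=> l; have := H (lift ord0 l); rewrite !tnthS.
by case: (unliftP ord0 l) => [j|] ->; rewrite ?tnthS ?tnth0.
Qed.

Lemma Zpos_cons k a (v : k.-tuple nat) :
  Zpos [tuple of a :: v] <-> 0 < a /\ Zpos v.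
Proof. exact: (forall_tnth_cons (fun x _ => 0 < x) a a v v). Qed.

Lemma box_cons k a m (v n : k.-tuple nat) :
  box [tuple of m :: n] [tuple of a :: v] <-> 1 <= a <= m /\ box n v.
Proof. exact: (forall_tnth_cons (fun x y => 1 <= x <= y) a m v n). Qed.

Lemma add_unit_cons0 k a (v : k.-tuple nat) :
  add_unit [tuple of a :: v] (@ord0 k) = [tuple of a.+1 :: v].
Proof.
apply: eq_from_tnth => j; rewrite tnth_mktuple.
by case: (unliftP ord0 j) => [l|] ->; rewrite ?tnthS ?tnth0 /= ?addn0 ?addn1.
Qed.

Lemma reflect_box_cons k a m (n i : k.-tuple nat) :
  reflect_box [tuple of m :: n] [tuple of a :: i] =
  [tuple of (m + 1 - a) :: reflect_box n i].
Proof.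
apply: eq_from_tnth => j; rewrite tnth_mktuple.
by case: (unliftP ord0 j) => [l|] ->; rewrite ?tnthS ?tnth0 // tnth_mktuple.
Qed.

(* Unlike in tuple_eta, the tail is packaged as a k-tuple. *)
Lemma tuple_consE k (i : k.+1.-tuple nat) :
  i = [tuple of thead i :: behead_tuple i].
Proof. exact: tuple_eta. Qed.

Lemma rcons_tuple_inj k (i j : k.-tuple nat) (h h' : nat) :
  [tuple of rcons i h] = [tuple of rcons j h'] -> i = j /\ h = h'.
Proof.
by move=> /(congr1 val)/rcons_inj[/val_inj -> ->].
Qed.

Lemma rcons_tupleP k (v : k.+1.-tuple nat) :
  exists (i : k.-tuple nat) h, v = [tuple of rcons i h].
Proof.
case: v => s; case/lastP: s => [//|s h] sz.
have sz' : size s == k by move: sz; rewrite size_rcons.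
by exists (Tuple sz'), h; apply: val_inj.
Qed.

Lemma cons_rcons_tuple k (i : k.-tuple nat) (a h : nat) :
  [tuple of a :: [tuple of rcons i h]] =
  [tuple of rcons [tuple of a :: i] h].
Proof. exact: val_inj. Qed.

Lemma add_unit_rcons k (i : k.-tuple nat) (h : nat) (l : 'I_k) :
  add_unit [tuple of rcons i h] l = [tuple of rcons (add_unit i l) h].
Proof.
apply: eq_from_tnth => j; rewrite tnth_mktuple !(tnth_nth 0).
rewrite !nth_rcons !size_tuple.
have := ltn_ord j; case: (ltngtP j k) => [jk _|jk|jk _]; first last.
- by rewrite jk (gtn_eqF (ltn_ord l)) addn0.
- by rewrite ltnS leqNgt jk.
by rewrite -[nth 0 (add_unit i l) j](tnth_nth 0 _ (Ordinal jk)) tnth_mktuple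
  (tnth_nth 0).
Qed.

(** * Listing a box, first coordinate outermost *)

Fixpoint enum_box (k : nat) : k.-tuple nat -> seq (k.-tuple nat) :=
  match k with
  | 0 => fun=> [:: [tuple]]
  | k'.+1 => fun n : k'.+1.-tuple nat =>
      [seq [tuple of a :: tval v] | a <- index_iota 1 (thead n).+1,
                                    v <- enum_box (behead_tuple n)]
  end.

Lemma enum_box_cons k m (n : k.-tuple nat) :
  enum_box [tuple of m :: n] =
  [seq [tuple of a :: tval v] | a <- index_iota 1 m.+1, v <- enum_box n].
Proof.
rewrite /= theadE; congr (allpairs _ _ (enum_box _)); exact: val_inj.
Qed.

Lemma mem_enum_box k (n v : k.-tuple nat) : v \in enum_box n <-> box n v.
Proof.
elim: k n v => [|k IH] n v.
  by rewrite (tuple0 v) mem_seq1; split => [_ []|].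
rewrite (tuple_consE n) (tuple_consE v) enum_box_cons box_cons.
move: (thead v) (behead_tuple v) => {v} b v; split.
  case/allpairsP=> -[a u] /= [aI uI] /(congr1 val) [-> /val_inj ->].
  by split; [move: aI; rewrite mem_index_iota | apply/IH].
move=> [aI uI]; apply/allpairsP; exists (b, v).
by split; [rewrite mem_index_iota | apply/IH |].
Qed.

Lemma enum_box_uniq k (n : k.-tuple nat) : uniq (enum_box n).
Proof.
elim: k n => // k IH n; rewrite (tuple_consE n) enum_box_cons.
apply: allpairs_uniq; rewrite ?iota_uniq //.
by move=> [a u] [b v] _ _ /= /(congr1 val) [-> /val_inj ->].
Qed.

Lemma size_enum_box k (n : k.-tuple nat) :
  size (enum_box n) = \prod_(l < k) tnth n l.
Proof.
elim: k n => [|k IH] n; first by rewrite big_ord0.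
rewrite (tuple_consE n) enum_box_cons size_allpairs IH size_iota subn1.
by rewrite big_ord_recl tnth0; congr muln; apply: eq_bigr => l _; rewrite tnthS.
Qed.

(** Reflection is an involution of the box; this allows sums of weights to be reindexed by it. *)
Lemma perm_reflect_box k (n : k.-tuple nat) :
  perm_eq [seq reflect_box n i | i <- enum_box n] (enum_box n).
Proof.
apply: uniq_perm; rewrite ?enum_box_uniq //.
  rewrite map_inj_in_uniq ?enum_box_uniq // => i j /mem_enum_box bi.
  by move=> /mem_enum_box bj e; rewrite -(reflect_boxK bi) e reflect_boxK.
move=> v; apply/mapP/idP => [[i /mem_enum_box bi ->]|/mem_enum_box bv].
  exact/mem_enum_box/box_reflect.
exists (reflect_box n v); last by rewrite reflect_boxK.
exact/mem_enum_box/box_reflect.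
Qed.

(** * Last passage times *)

Definition paths_to (k : nat) (i : k.-tuple nat) : set (seq (k.-tuple nat)) :=
  [set s | directed_path [tuple of nseq k 1] i s].

Lemma Zpos_ones k : Zpos [tuple of nseq k 1].
Proof. by move=> l; rewrite (tnth_nth 0) nth_nseq ltn_ord. Qed.

Lemma paths_to_Zpos k (i : k.-tuple nat) s : paths_to i s -> Zpos i.
Proof.
case=> s' [_ + <-]; move: [tuple of nseq k 1] (@Zpos_ones k) => u.
elim: s' u => //= v s' IH u u0 /andP[/existsP[l /eqP ->]].
exact/IH/Zpos_add_unit.
Qed.

(** Splitting a path at its last step, not its first, keeps the starting point (1, ..., 1) fixed, as
    the recursion for [lpp] requires. *)
Lemma paths_to_inv k (i : k.-tuple nat) s : paths_to i s ->
  (i = [tuple of nseq k 1] /\ s = [:: i]) \/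
  exists (l : 'I_k) s', paths_to (sub_unit i l) s' /\ s = rcons s' i.
Proof.
case=> s' [-> + <-]; case/lastP: s' => [_|s' v]; first by left.
rewrite rcons_path last_rcons => /andP[ps /existsP[l /eqP ->]].
right; exists l, ([tuple of nseq k 1] :: s'); rewrite add_unitK; split => //.
by exists s'.
Qed.

Lemma paths_to_rcons k (i : k.-tuple nat) (l : 'I_k) s :
  paths_to (sub_unit i l) s -> paths_to i (rcons s i).
Proof.
move=> p; have /sub_unitK e := paths_to_Zpos p; case: p => s' [-> ps ls].
exists (rcons s' i); rewrite last_rcons rcons_path ps ls /=; split => //.
by apply/existsP; exists l; rewrite e.
Qed.

(** Induction on the coordinate sum: a path is a single vertex or extends a path to one of the k
    predecessors of its end. *)
Lemma finite_paths_to k (i : k.-tuple nat) : finite_set (paths_to i).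
Proof.
have [m] := ubnP (\sum_(j < k) tnth i j); elim: m i => // m IH i im.
have fin (l : 'I_k) : finite_set (paths_to (sub_unit i l)).
  (* A predecessor in Z_+^k has coordinate sum one less; outside Z_+^k no path ends. *)
  have [v0|v0] := pselect (Zpos (sub_unit i l)).
    by apply: IH; rewrite -{1}(sub_unitK v0) sum_add_unit in im.
  apply: (@sub_finite_set _ _ set0) => // s; by move/paths_to_Zpos.
apply: (@sub_finite_set _ _ ([set [:: i]] `|`
  \bigcup_(l in [set: 'I_k]) ((rcons^~ i) @` paths_to (sub_unit i l)))).
  move=> s /paths_to_inv [[_ ->]|[l [s' [ps ->]]]]; first by left.
  by right; exists l => //; exists s'.
rewrite finite_setU; split; first exact: finite_set1.
by apply: bigcup_finite => // l _; exact: finite_image.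
Qed.

(** Walk back along any coordinate different from 1 until all of them equal 1. *)
Lemma paths_to_ex k (i : k.-tuple nat) : Zpos i -> exists s, paths_to i s.
Proof.
have [m] := ubnP (\sum_(j < k) tnth i j); elim: m i => // m IH i im i0.
have [/forallP i1|] := boolP [forall l, tnth i l == 1].
  exists [:: i], [::]; split => //=; first congr cons;
    apply: eq_from_tnth => l; rewrite (eqP (i1 l)) (tnth_nth 0) nth_nseq;
    by rewrite ltn_ord.
rewrite negb_forall => /existsP[l il].
have u0 : Zpos (sub_unit i l).
  move=> j; rewrite tnth_mktuple; have := i0 j.
  have [->|] := eqVneq j l; first by move: il (i0 l); lia.
  by rewrite -(inj_eq val_inj) /=; lia.
have [|s ps] := IH _ _ u0.
  by rewrite -{1}(sub_unitK u0) sum_add_unit in im.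
by exists (rcons s i); apply: paths_to_rcons ps.
Qed.

(** Finiteness of the set of paths makes the maximum a genuine one; the recursion is derived from
    this description by upper bounds. *)
Lemma lpp_leP k (w : k.-tuple nat -> nat) i m :
  lpp w i <= m <-> forall s, paths_to i s -> \sum_(j <- s) w j <= m.
Proof.
have fin := finite_paths_to i.
rewrite /lpp fsbig_finite //; split.
  move=> /bigmax_leqP_seq H s ps; apply: H => //.
  by rewrite in_fset_set // inE.
by move=> H; apply/bigmax_leqP_seq => s; rewrite in_fset_set // inE => /H.
Qed.

Lemma lpp_nZpos k (w : k.-tuple nat -> nat) i : ~ Zpos i -> lpp w i = 0.
Proof.
move=> i0; apply/eqP; rewrite -leqn0; apply/lpp_leP => s.
by move/paths_to_Zpos.
Qed.

(* When i_l = 1 the l-th term of the maximum is 0 by lpp_nZpos. *)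
Lemma lpp_rec k (w : k.-tuple nat -> nat) i : Zpos i ->
  lpp w i = w i + \max_(l < k) lpp w (sub_unit i l).
Proof.
move=> i0; apply/eqP; rewrite eqn_leq; apply/andP; split.
  apply/lpp_leP => s /paths_to_inv [[_ ->]|[l [s' [ps ->]]]].
    by rewrite big_seq1 leq_addr.
  rewrite big_rcons /= addnC leq_add2l.
  by apply: leq_trans (leq_bigmax l); apply: (lpp_leP _ _ _).1 ps.
(* Some path to [i] exists and ends with the weight [w i]. This inequality permits moving [w i]
   across by subtraction of naturals. *)
have wi : w i <= lpp w i.
  have [s ps] := paths_to_ex i0.
  apply: leq_trans ((lpp_leP _ _ _).1 (leqnn _) _ ps).
  case/paths_to_inv: ps => [[_ ->]|[l [s' [_ ->]]]]; first by rewrite big_seq1.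
  by rewrite big_rcons /= leq_addl.
rewrite -leq_subRL //; apply/bigmax_leqP => l _; apply/lpp_leP => s ps.
rewrite leq_subRL // addnC.
have := (lpp_leP w i _).1 (leqnn _) _ (paths_to_rcons ps).
by rewrite big_rcons /=.
Qed.

(** * The partition of last passage times *)

Definition next_max (k : nat) (tau : k.-tuple nat -> nat) (i : k.-tuple nat) :=
  \max_(l < k) tau (add_unit i l).

(** For positive [i] and any [tau], the number of corners above [i], by [Cor_rcons]; for a
    partition, also the weight that recovers [tau] through the recursion. *)
Definition corner_weight (k : nat) (tau : k.-tuple nat -> nat) i :=
  tau i - next_max tau i.

(** The guard is essential: a zero coordinate of [i] reflects to a positive one, where [lpp] need
    not vanish, while a partition must be 0 off Z_+^k. *)
Definition lpp_partition (k : nat) (N : k.-tuple nat) (w : k.-tuple nat -> nat)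
    (i : k.-tuple nat) : nat :=
  if `[< Zpos i >] then lpp w (reflect_box N i) else 0.

Lemma lpp_partitionE k (N : k.-tuple nat) w i : Zpos i ->
  lpp_partition N w i = lpp w (reflect_box N i).
Proof. by move=> i0; rewrite /lpp_partition asboolT. Qed.

Lemma lpp_partition_nbox k (N : k.-tuple nat) w i : ~ box N i ->
  lpp_partition N w i = 0.
Proof.
move=> nb; have [i0|i0] := pselect (Zpos i); last first.
  by rewrite /lpp_partition asboolF.
by rewrite lpp_partitionE // lpp_nZpos //; apply: reflect_box_nZpos.
Qed.

Lemma lpp_partition_rec k (N : k.-tuple nat) w i : box N i ->
  lpp_partition N w i =
  w (reflect_box N i) + next_max (lpp_partition N w) i.
Proof.
move=> b; have i0 := box_Zpos b; have r0 := box_Zpos (box_reflect b).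
rewrite lpp_partitionE // lpp_rec //; congr addn; apply: eq_bigr => l _.
by rewrite lpp_partitionE ?reflect_add_unit //; apply: Zpos_add_unit.
Qed.

Lemma finite_box k (N : k.-tuple nat) : finite_set (box N).
Proof.
apply: (@sub_finite_set _ _ [set` enum_box N]); last exact: finite_seq.
by move=> i /mem_enum_box.
Qed.

Lemma lpp_partitionP k (N : k.-tuple nat) w : is_partition (lpp_partition N w).
Proof.
split=> [i i0||i l i0].
- by rewrite lpp_partition_nbox // => /box_Zpos.
- apply: sub_finite_set (finite_box N) => i /= i0; apply: contrapT => nb.
  by rewrite lpp_partition_nbox in i0.
- have [b|nb] := pselect (box N i); last first.
    by rewrite lpp_partition_nbox //; apply: add_unit_nbox.
  rewrite [leqRHS]lpp_partition_rec //; apply: leq_trans (leq_addl _ _).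
  exact: (leq_bigmax (F := fun j : 'I_k => lpp_partition N w (add_unit i j)) l).
Qed.

Lemma next_max_le k (tau : k.-tuple nat -> nat) i :
  is_partition tau -> Zpos i -> next_max tau i <= tau i.
Proof. by case=> _ _ mono i0; apply/bigmax_leqP => l _; apply: mono. Qed.

(** This is the bijection between weights on the box and partitions supported there: the recursion
    determines each from the other. *)
Lemma lpp_partition_eqP k (N : k.-tuple nat) w tau :
  is_partition tau -> (forall i, ~ box N i -> tau i = 0) ->
  lpp_partition N w = tau <->
  forall i, box N i -> w (reflect_box N i) = corner_weight tau i.
Proof.
move=> ptau tau0; split=> [<- i b|H].
  by rewrite /corner_weight lpp_partition_rec // addnK.
(* Induction from the far corner [N] towards the origin, along the coordinate sum: forward
   neighbours are settled first. *)
suff HL m i : \sum_l tnth N l < m + \sum_l tnth i l ->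
    lpp_partition N w i = tau i.
  by apply/funext => i; apply: (HL (\sum_l tnth N l).+1); rewrite leq_addr.
elim: m i => [|m IH] i.
  (* For m = 0 the coordinate sum of [i] exceeds that of [N], so [i] is outside the box and both
     sides are 0. *)
  have [b|nb _] := pselect (box N i); last by rewrite lpp_partition_nbox ?tau0.
  rewrite add0n ltnNge => /negP[]; apply: leq_sum => l _.
  by case/andP: (b l).
move=> im; have [b|nb] := pselect (box N i); last first.
  by rewrite lpp_partition_nbox ?tau0.
rewrite lpp_partition_rec // H //.
have -> : next_max (lpp_partition N w) i = next_max tau i.
  by apply: eq_bigr => l _; apply: IH; rewrite sum_add_unit addnS.
by rewrite subnK //; apply: next_max_le => //; apply: box_Zpos b.
Qed.

(** * Diagrams and corners *)

Lemma diagram_rcons k (tau : k.-tuple nat -> nat) (i : k.-tuple nat) (h : nat) :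
  diagram tau [tuple of rcons i h] <-> Zpos i /\ 1 <= h <= tau i.
Proof.
split=> [[j [h' [/rcons_tuple_inj[-> ->] //]]]|[i0 hi]].
by exists i, h.
Qed.

Lemma diagram_sub_cylinderP k (N : k.-tuple nat) tau : is_partition tau ->
  diagram tau `<=` cylinder N <-> forall i, ~ box N i -> tau i = 0.
Proof.
move=> [tau0 _ _]; split=> [H i nb|H v [i [h [-> i0 hi]]]].
  apply: contrapT => ti.
  have i0 : Zpos i by apply: contrapT => /tau0.
  (* The top cell above [i] witnesses that [i] lies in the box. *)
  have : diagram tau [tuple of rcons i (tau i)].
    by apply/diagram_rcons; split=> //; lia.
  by move=> /H[j [h [/rcons_tuple_inj[<- _]]]].
exists i, h; split=> //; last by case/andP: hi.
by apply: contrapT => /H ti; rewrite ti in hi; lia.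
Qed.

Lemma partition_cons_le k (tau : k.+1.-tuple nat -> nat) a (i : k.-tuple nat) :
  is_partition tau -> tau [tuple of a :: i] <= tau [tuple of 1 :: i].
Proof.
move=> [tau0 _ mono].
have [ai0|ai0] := pselect (Zpos [tuple of a :: i]); last by rewrite tau0.
have [a0 i0] := (Zpos_cons _ _).1 ai0.
elim: a a0 {ai0} => // -[|a] IH _ //.
apply: leq_trans (IH isT); rewrite -add_unit_cons0.
by apply: mono; apply/Zpos_cons.
Qed.

(** As [tau] decreases in its first coordinate, the projection along it is the diagram of the slice
    at 1. *)
Lemma sh1_eqP k (tau : k.+1.-tuple nat -> nat) rho : is_partition tau ->
  sh1 tau = diagram rho <->
  forall i : k.-tuple nat, Zpos i -> tau [tuple of 1 :: i] = rho i.
Proof.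
move=> ptau.
have sh (i : k.-tuple nat) (h : nat) : sh1 tau [tuple of rcons i h] <->
    Zpos i /\ 1 <= h <= tau [tuple of 1 :: i].
  split=> [[a]|[i0 hi]].
    rewrite cons_rcons_tuple => /diagram_rcons[/Zpos_cons[a0 i0] hi].
    by split=> //; have := partition_cons_le a i ptau; lia.
  exists 1; rewrite cons_rcons_tuple; apply/diagram_rcons; split=> //.
  exact/Zpos_cons.
split=> [E i i0|E].
  (* If the two heights above [i] differed, the top cell of the higher column would lie in only one
     of the two sets. *)
  apply/eqP; rewrite eqn_leq; apply/andP; split; rewrite leqNgt; apply/negP.
    move=> lt; have : sh1 tau [tuple of rcons i (tau [tuple of 1 :: i])].
      by apply/sh; split=> //; lia.
    by rewrite E => /diagram_rcons[_]; lia.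
  move=> lt; have : diagram rho [tuple of rcons i (rho i)].
    by apply/diagram_rcons; split=> //; lia.
  by rewrite -E => /sh[_]; lia.
apply/seteqP; split=> v; have [i [h ->]] := rcons_tupleP v.
  by move=> /sh[i0 hi]; apply/diagram_rcons; rewrite -E.
by move=> /diagram_rcons[i0 hi]; apply/sh; rewrite E.
Qed.

(** The height direction is not tested, so the corners above [i] fill the whole interval above the
    tallest forward neighbour. *)
Lemma Cor_rcons k (tau : k.-tuple nat -> nat) (i : k.-tuple nat) (h : nat) :
  Cor tau [tuple of rcons i h] <-> Zpos i /\ next_max tau i < h <= tau i.
Proof.
split=> [[/diagram_rcons[i0 /andP[h0 hi]] H]|[i0 /andP[mh hi]]].
  split=> //; rewrite hi andbT -(prednK h0) ltnS; apply/bigmax_leqP => l _.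
  rewrite -ltnS (prednK h0) ltnNge; apply/negP => hl; apply: (H l).
  rewrite add_unit_rcons; apply/diagram_rcons; rewrite h0; split=> //.
  exact: Zpos_add_unit.
split; first by apply/diagram_rcons; split=> //; lia.
move=> l; rewrite add_unit_rcons => /diagram_rcons[_].
have := leq_bigmax (F := fun l : 'I_k => tau (add_unit i l)) l.
by move: mh; rewrite /next_max /=; lia.
Qed.

Lemma card_fset_set_uniq (T : choiceType) (A : set T) (s : seq T) : uniq s ->
  (forall x, A x <-> x \in s) -> #|` fset_set A|%fset = size s.
Proof.
move=> us As; apply: perm_size; apply: uniq_perm => // x.
have finA : finite_set A.
  by apply: (@sub_finite_set _ _ [set` s]) => [y /As //|]; exact: finite_seq.
by rewrite in_fset_set //; apply/idP/idP; rewrite inE => /As.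
Qed.

(** Corners in layer [a] are counted column by column; columns off the box are empty. *)
Lemma cor_countE p m (n : p.-tuple nat) (tau : p.+1.-tuple nat -> nat) a :
  (forall i, ~ box [tuple of m :: n] i -> tau i = 0) -> 0 < a ->
  cor_count a tau =
  \sum_(i <- enum_box n) corner_weight tau [tuple of a :: i].
Proof.
move=> tau0 a0.
(* The interval of [Cor_rcons] as a list: it starts just above [next_max]. *)
pose heights (i : p.-tuple nat) := iota (next_max tau [tuple of a :: i]).+1
  (corner_weight tau [tuple of a :: i]).
rewrite /cor_count (@card_fset_set_uniq _ _
  [seq [tuple of rcons (tval i) h] | i <- enum_box n, h <- heights i]).
- rewrite size_allpairs_dep sumnE big_map.
  by apply: eq_bigr => i _; rewrite size_iota.
- apply: allpairs_uniq_dep => [|i _|]; rewrite ?enum_box_uniq ?iota_uniq //.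
  by move=> [i h] [j h'] _ _ /= /rcons_tuple_inj[-> ->].
move=> v; have [i [h ->]] := rcons_tupleP v; rewrite /= cons_rcons_tuple.
split.
  move=> /Cor_rcons[i0 hi]; apply/allpairsPdep; exists i, h; split=> //.
    apply/mem_enum_box; apply: contrapT => nb.
    by rewrite (tau0 [tuple of a :: i]) in hi; [lia | case/box_cons].
  by rewrite mem_iota /corner_weight; lia.
move=> /allpairsPdep[j [h' [jn]]].
rewrite mem_iota /corner_weight => hj /rcons_tuple_inj[-> ->].
apply/Cor_rcons; split; last by lia.
by apply/Zpos_cons; split=> //; apply/(@box_Zpos _ n)/mem_enum_box.
Qed.

(** * Partitions with a prescribed shape *)

Lemma finite_bounded_funs (T : choiceType) (e : seq T) (M : nat) :
  finite_set [set f : T -> nat |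
    (forall x, f x <= M) /\ forall x, x \notin e -> f x = 0].
Proof.
(* A finite function on positions of [e] is extended to [T]; off the list, [index] equals the size,
   [insub] fails and the value is 0. *)
pose ext (t : {ffun 'I_(size e) -> 'I_M.+1}) (x : T) : nat :=
  if insub (index x e) is Some j then t j else 0.
apply: (@sub_finite_set _ _ (range ext)); last first.
  exact/finite_image/finite_finset.
move=> f [fM f0]; exists [ffun j => inord (f (tnth (in_tuple e) j))] => //.
apply/funext => x; rewrite /ext; case: insubP => [j _ jx|].
  rewrite ffunE inordK ?ltnS // (tnth_nth x) jx nth_index //.
  by rewrite -index_mem -jx ltn_ord.
by rewrite index_mem => /f0 ->.
Qed.

Definition shape_partitions (p m : nat) (n : p.-tuple nat)
    (rho : p.-tuple nat -> nat) : set (p.+1.-tuple nat -> nat) :=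
  [set tau | [/\ is_partition tau, diagram tau `<=` cylinder [tuple of m :: n]
               & sh1 tau = diagram rho]].

(** Values are bounded by those of the slice at 1, which is [rho]. Hence the sum in [g] is finite
    and the event is a finite union. *)
Lemma finite_shape_partitions p m (n : p.-tuple nat) rho :
  finite_set (shape_partitions m n rho).
Proof.
apply: sub_finite_set (finite_bounded_funs (enum_box [tuple of m :: n])
  (\max_(i <- enum_box n) rho i)) => tau [ptau /diagram_sub_cylinderP tau0 sh].
split=> [x|x xN]; last first.
  by apply: tau0 => // /mem_enum_box xN'; rewrite xN' in xN.
have [b|/tau0 -> //] := pselect (box [tuple of m :: n] x).
move: b; rewrite (tuple_consE x); set a := thead x; set i := behead_tuple x.
move=> /box_cons[_ b]; apply: leq_trans (partition_cons_le _ _ ptau) _.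
rewrite ((sh1_eqP _ ptau).1 sh); last exact: box_Zpos b.
by apply: leq_bigmax_seq => //; apply/mem_enum_box.
Qed.

(** The slice at first coordinate 1 reflects to first coordinate m + 1 - 1 = m, so prescribing the
    shape is exactly the event of the theorem. *)
Lemma lpp_partition_shapeP p m (n : p.-tuple nat) rho w :
  0 < m -> is_partition rho -> diagram rho `<=` cylinder n ->
  shape_partitions m n rho (lpp_partition [tuple of m :: n] w) <->
  forall i, box n i -> lpp w [tuple of m :: reflect_box n i] = rho i.
Proof.
move=> m0 prho /(diagram_sub_cylinderP _ prho) rho0.
have pL := lpp_partitionP [tuple of m :: n] w.
have L1 i : Zpos i -> lpp_partition [tuple of m :: n] w [tuple of 1 :: tval i] =
    lpp w [tuple of m :: reflect_box n i].
  by move=> i0; rewrite lpp_partitionE ?Zpos_cons // reflect_box_cons addnK.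
split=> [[_ _ /(sh1_eqP _ pL) sh] i b|H].
  by have i0 := box_Zpos b; rewrite -L1 // sh.
split=> //.
  by apply/diagram_sub_cylinderP => // i; exact: lpp_partition_nbox.
apply/sh1_eqP => // i i0; have [b|nb] := pselect (box n i).
  by rewrite L1 // H.
by rewrite rho0 // lpp_partition_nbox // => /box_cons[].
Qed.

(** * Geometric weights *)

Local Open Scope ring_scope.

Lemma prob_weights (disp : measure_display) (T : measurableType disp)
    (R : realType) (P : probability T R) (k : nat) (q : R)
    (w : k.-tuple nat -> {RV P >-> nat}) (N : k.-tuple nat)
    (c : k.-tuple nat -> nat) :
  mutually_independent (@Zpos k) w ->
  (forall i, Zpos i -> forall h : nat,
     P [set t | w i t = h] = ((1 - q) * q ^+ h)%:E) ->
  let E := [set t | forall i, box N i -> w (reflect_box N i) t = c i] in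
  measurable E /\
  P E = ((1 - q) ^+ (\prod_(l < k) tnth N l)%N *
         q ^+ (\sum_(i <- enum_box N) c i)%N)%:E.
Proof.
move=> ind geo E.
(* The prescribed values are reindexed by the position of the weight, so that [E] is an intersection
   of constraints on single variables. *)
pose J := fset_set (box N); pose A i := [set c (reflect_box N i)].
have finb := finite_box N.
have JE : [set` J] = box N by rewrite fset_setK.
have EJ : E = \bigcap_(i in [set` J]) (w i @^-1` A i).
  rewrite JE; apply/seteqP; split=> t /= H i b.
    by have := H _ (box_reflect b); rewrite reflect_boxK.
  by have := H _ (box_reflect b); rewrite /A /= reflect_boxK.
split.
  rewrite EJ JE; apply: fin_bigcap_measurable => // i _.
  exact: measurable_funPTI.
rewrite EJ ind //; last by rewrite JE => i /box_Zpos.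
have pJ : perm_eq J (enum_box N).
  apply: uniq_perm; rewrite ?fset_uniq ?enum_box_uniq // => i.
  rewrite in_fset_set //; apply/idP/idP; rewrite inE.
    by move/mem_enum_box.
  by move=> ?; apply/mem_enum_box.
rewrite (perm_big _ pJ) /= big_seq.
under eq_bigr => i /mem_enum_box/box_Zpos i0 do rewrite (geo i i0 _).
rewrite -big_seq prodEFin big_split /= big_const_seq count_predT iter_mulr_1.
rewrite size_enum_box -(big_morph _ (@exprD R q) (expr0 q)).
(* Reindexing the exponent by the reflection cancels the one inside [c]. *)
rewrite -(perm_big _ (perm_reflect_box N)) /= big_map.
congr ((_ * _ ^+ _)%:E); apply: eq_big_seq => i /mem_enum_box b.
by rewrite reflect_boxK.
Qed.

Lemma prod_cor_count (R : comNzRingType) (q : R) p m (n : p.-tuple nat)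
    (tau : p.+1.-tuple nat -> nat) :
  (forall i, ~ box [tuple of m :: n] i -> tau i = 0%N) ->
  \prod_(i < m) tnth [tuple of nseq m q] i ^+ cor_count i.+1 tau =
  q ^+ (\sum_(i <- enum_box [tuple of m :: n]) corner_weight tau i)%N.
Proof.
(* The box is cut into layers; the shift by one matches [cor_count i.+1], as layers start at 1 and
   variables at 0. *)
move=> tau0; rewrite enum_box_cons big_allpairs_dep big_add1 big_mkord.
rewrite (big_morph _ (@exprD R q) (expr0 q)); apply: eq_bigr => i _.
by rewrite (cor_countE tau0) // (tnth_nth 0) nth_nseq ltn_ord.
Qed.

(* d = p + 1; the tuple n is (n_2, ..., n_d). *)
Theorem theorem7p1 (disp : measure_display) (T : measurableType disp)
    (R : realType) (P : probability T R) (p : nat) (q : R)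
    (w : p.+1.-tuple nat -> {RV P >-> nat})
    (n1 : nat) (n : p.-tuple nat) (rho : p.-tuple nat -> nat) :
  0 < q < 1 ->
  mutually_independent (@Zpos p.+1) w ->
  (forall i, Zpos i -> forall k : nat,
     P [set t | w i t = k] = ((1 - q) * q ^+ k)%:E) ->
  (0 < n1)%N -> Zpos n ->
  is_partition rho -> diagram rho `<=` cylinder n ->
  P [set t | forall i, box n i ->
       lpp (fun j => w j t)
           [tuple of n1 :: [tuple (tnth n l + 1 - tnth i l)%N | l < p]]
       = rho i]
  = ((1 - q) ^+ (n1 * \prod_(l < p) tnth n l)%N *
     g n rho [tuple of nseq n1 q])%:E.
Proof.
move=> _ ind geo n10 _ prho rhon.
pose N := [tuple of n1 :: n]; pose W t j : nat := w j t.
(* Fibres of the map from outcomes to partitions: being preimages of distinct points, they are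
   disjoint. *)
pose E tau := (fun t => lpp_partition N (W t)) @^-1` [set tau].
have finA := finite_shape_partitions n1 n rho.
rewrite [X in P X](_ : _ = \bigcup_(tau in shape_partitions n1 n rho) E tau);
  last first.
  apply/seteqP; split=> t /=.
    move=> /(lpp_partition_shapeP _ n10 prho rhon) H.
    by exists (lpp_partition N (W t)).
  by move=> [tau + Et]; rewrite -Et => /(lpp_partition_shapeP _ n10 prho rhon).
have EE tau : shape_partitions n1 n rho tau -> measurable (E tau) /\
    P (E tau) = ((1 - q) ^+ (n1 * \prod_(l < p) tnth n l)%N *
      \prod_(i < n1) tnth [tuple of nseq n1 q] i ^+ cor_count i.+1 tau)%:E.
  move=> [ptau /(diagram_sub_cylinderP _ ptau) tau0 _].
  (* Inverting the bijection turns each fibre into prescribed values of the independent weights. *)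
  have -> : E tau = [set t | forall i, box N i ->
      w (reflect_box N i) t = corner_weight tau i].
    by apply/seteqP; split=> t /= /(lpp_partition_eqP (W t) ptau tau0).
  have [mE ->] := prob_weights N (corner_weight tau) ind geo.
  split=> //; rewrite (prod_cor_count _ tau0) big_ord_recl tnth0.
  congr ((_ ^+ (_ * _)%N * _)%:E); apply: eq_bigr => l _.
  by rewrite tnthS.
rewrite measure_fin_bigcup //; first last.
- by move=> tau /EE[].
- exact: trivIset_preimage1.
rewrite (eq_fsbigr (fun tau => ((1 - q) ^+ (n1 * \prod_(l < p) tnth n l)%N *
  \prod_(i < n1) tnth [tuple of nseq n1 q] i ^+ cor_count i.+1 tau)%:E));
  last by move=> tau; rewrite inE => /EE[].
rewrite fsumEFin // /g; congr EFin.
by rewrite !fsbig_finite // big_distrr.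
Qed.
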